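(* For every integer $a$ and every integer $N \geq 1$, $$ \left| \{ i : 0 \leq i < 2^N,\ s(i) = a \} \right| = \binom{N-1}{\lfloor (N-a)/2 \rfloor}, $$ where the binomial coefficient $\binom{m}{k}$ is taken to be $0$ when $k<0$ or $k>m$.
   Context: The infinity series $(s(n))_{n \geq 0}$ is the integer sequence defined by $s(0)=0$, $s(2n) = -s(n)$ for $n \geq 1$, and $s(2n+1) = s(n)+1$ for $n \geq 0$. *)

(* Defs.v *)
From mathcomp Require Import all_boot all_order all_algebra.
From mathcomp Require Import zify.

Set Implicit Arguments.
Unset Strict Implicit.
Unset Printing Implicit Defensive.

Import GRing.Theory.
Local Open Scope ring_scope.

(* [k] is recursion fuel; any [k >= n] gives the same value
   ([infinity_fuelE]). *)
Fixpoint infinity_fuel (k n : nat) : int :=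
  if k is k'.+1 then
    if n == 0%N then 0
    else if odd n then infinity_fuel k' n./2 + 1
    else - infinity_fuel k' n./2
  else 0.

(* The infinity series; its defining recurrence is given by [infinity_series0],
   [infinity_series_double] and [infinity_series_doubleS], and
   [infinity_series_unique] shows that the recurrence determines it. *)
Definition infinity_series (n : nat) : int := infinity_fuel n n.

Lemma infinity_fuelE (k n : nat) :
  (n <= k)%N -> infinity_fuel k n = infinity_series n.
Proof.
rewrite /infinity_series.
have H: forall k l m, (m <= k)%N -> (m <= l)%N ->
    infinity_fuel k m = infinity_fuel l m.
  elim=> [|k' IH] [|l] m.
  - by [].
  - by rewrite leqn0 => /eqP ->.
  - by rewrite leqn0 => _ /eqP ->.
  - move=> /= hk hl; case: eqP => // /eqP m0.
    by rewrite (IH l m./2) //; lia.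
by move=> le_nk; apply: H.
Qed.

Lemma infinity_series0 : infinity_series 0 = 0.
Proof. by []. Qed.

Lemma infinity_series_double (n : nat) :
  (1 <= n)%N -> infinity_series (2 * n) = - infinity_series n.
Proof.
case: n => // n _; rewrite -[LHS]/(infinity_fuel (2 * n.+1) (2 * n.+1)).
rewrite -(@infinity_fuelE (2 * n + 1)%N n.+1); last by lia.
have -> : (2 * n.+1 = (2 * n + 1).+1)%N by lia.
rewrite [LHS]/=.
have -> : odd (2 * n + 1) by lia.
by congr (- infinity_fuel _ _); lia.
Qed.

Lemma infinity_series_doubleS (n : nat) :
  infinity_series (2 * n + 1) = infinity_series n + 1.
Proof.
rewrite -(@infinity_fuelE (2 * n)%N n); last by lia.
rewrite addn1 -[LHS]/(infinity_fuel (2 * n).+1 (2 * n).+1) [LHS]/=.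
have -> : ~~ odd (2 * n) by lia.
by congr (infinity_fuel _ _ + 1); lia.
Qed.

Lemma infinity_series_unique (s : nat -> int) :
  s 0%N = 0 ->
  (forall n : nat, (1 <= n)%N -> s (2 * n)%N = - s n) ->
  (forall n : nat, s (2 * n + 1)%N = s n + 1) ->
  s =1 infinity_series.
Proof.
move=> s0 se so n; elim/ltn_ind: n => n IH.
case: (posnP n) => [-> //|n0].
case: (boolP (odd n)) => on.
  have -> : n = (2 * n./2 + 1)%N by lia.
  by rewrite so infinity_series_doubleS IH //; lia.
have -> : n = (2 * n./2)%N by lia.
by rewrite se ?infinity_series_double ?IH //; lia.
Qed.

(* Binomial coefficient with integer lower index, 0 when [k < 0]; the value 0
   for [k > m] is the library's convention ([bin_small]). *)
Definition binz (m : nat) (k : int) : nat :=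
  if 0 <= k then 'C(m, `|k|%N) else 0%N.

(* Main.v *)
Require Import Defs.
From mathcomp Require Import all_boot all_order all_algebra.
From mathcomp Require Import zify.

Set Implicit Arguments.
Unset Strict Implicit.
Unset Printing Implicit Defensive.

Local Open Scope ring_scope.

(** Write c N a for the number of i < 2^N with s(i) = a. Splitting by parity,
    c (N + 1) a = c N (- a) + c N (a - 1). With p = floor((N + a) / 2) and
    q = floor((N + 1 - a) / 2), exactly one of the numerators is odd, so
    p + q = N; the symmetry of the binomial coefficients then turns this
    recurrence into Pascal's rule. *)

Lemma sum_double (F : nat -> nat) (n : nat) :
  (\sum_(i < 2 * n) F i =
     \sum_(i < n) F (2 * i)%N + \sum_(i < n) F (2 * i + 1)%N)%N.
Proof.
elim: n => [|n IHn]; first by rewrite !big_ord0.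
have -> : (2 * n.+1 = (2 * n).+2)%N by lia.
by rewrite !big_ord_recr /= IHn addn1 -addnA addnACA.
Qed.

Lemma infinity_count_rec (a : int) (N : nat) :
  (\sum_(i < 2 ^ N.+1) (infinity_series i == a) =
     \sum_(i < 2 ^ N) (infinity_series i == (- a)%R) +
     \sum_(i < 2 ^ N) (infinity_series i == (a - 1)%R))%N.
Proof.
rewrite expnS (sum_double (fun i => (infinity_series i == a) : nat)).
congr addn; apply: eq_bigr => i _; last first.
  by rewrite infinity_series_doubleS; lia.
(* The doubling rule excludes [i = 0], where both sides are 0. *)
have -> : infinity_series (2 * i)%N = - infinity_series i.
  by case: (posnP i) => [->|/infinity_series_double].
by lia.
Qed.

Lemma binz_nat (m k : nat) : binz m k%:Z = 'C(m, k).
Proof. by []. Qed.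

Lemma binz_neg (m : nat) (k : int) : k < 0 -> binz m k = 0%N.
Proof. by move=> k0; rewrite /binz ifF //; lia. Qed.

(** For 1 <= k <= m + 1, symmetry turns the first term into C(m, k - 1), which leaves Pascal's rule.
    For any other [k] the first term vanishes and the other two agree. *)
Lemma binz_pascal_sym (m : nat) (k : int) :
  (binz m (m.+1%:Z - k) + binz m k)%N = binz m.+1 k.
Proof.
case: k => [[|k]|k]; last 1 first.
- have -> : m.+1%:Z - Negz k = (m.+1 + k.+1)%N by lia.
  by rewrite !(@binz_neg _ (Negz k)) // binz_nat bin_small //; lia.
- have -> : m.+1%:Z - 0%N%:Z = m.+1 by lia.
  by rewrite !binz_nat !bin0 bin_small.
rewrite !binz_nat; case: (leqP k m) => le_km.
  have -> : m.+1%:Z - k.+1%:Z = (m - k)%N by lia.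
  by rewrite binz_nat bin_sub // binS addnC.
by rewrite binz_neg ?bin_small //; lia.
Qed.

Theorem theorem3 (a : int) (N : nat) (hN : (1 <= N)%N) :
  #|[set i : 'I_(2 ^ N)%N | infinity_series i == a]|
    = binz N.-1 ((N%:Z - a) %/ 2)%Z.
Proof.
rewrite cardsE -sum1_card big_mkcond /=.
under eq_bigr => i _ do rewrite unfold_in -[if _ then _ else _]/(nat_of_bool _).
case: N hN => // N _; elim: N a => [|N IHN] a.
  (* The values are s(0) = 0 and s(1) = 1, and floor((1 - a) / 2) = 0 exactly when [a] is 0 or 1. *)
  rewrite expn1 !big_ord_recr big_ord0.
  rewrite -[LHS]/((0%R == a) + (1%R == a))%N.
  by rewrite /binz; case: ifP => k0; rewrite ?bin0n; lia.
rewrite infinity_count_rec !IHN -binz_pascal_sym.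
(* With [N.+1] as the exponent N of the overview, the first indices agree by p + q = N + 1. *)
by congr (binz _ _ + binz _ _)%N; lia.
Qed.
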